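(* For every $X\in\mathcal{O}^{d,r}$, $\partial_{\mathrm R}|_{\tilde w}w(X)\subseteq\partial_{\mathrm R}w(X)$.
   Context: $1\le r<d$, $\mathcal{O}^{d,r}=\{X\in\mathbb{R}^{d\times r}:X^\top X=I_r\}$ with tangent space $\mathcal{T}_X\mathcal{O}^{d,r}=\{D:X^\top D+D^\top X=0\}$ and orthogonal projection $\mathrm{Proj}_{\mathcal{T}_X}(V)=V-X(X^\top V+V^\top X)/2$. For a function $F$ smooth near $X$, the Riemannian gradient is $\mathrm{grad}\,F(X)=\mathrm{Proj}_{\mathcal{T}_X}(\nabla F(X))$. For a locally Lipschitz $F:\mathcal{O}^{d,r}\to\mathbb{R}$, with $\Omega(F)$ the set of points where $F$ is differentiable, the Riemannian Clarke subdifferential is $\partial_{\mathrm R}F(X)=\mathrm{conv}\{D\in\mathcal{T}_X\mathcal{O}^{d,r}:\mathrm{grad}\,F(X_t)\to D\text{ for some }\Omega(F)\ni X_t\to X\}$. Fix $\Sigma_\circ\in\mathbb{S}_+^d$, $\rho>0$, $w(X)=2\rho\|(I_d-XX^\top)\Sigma_\circ^{1/2}\|_{\mathrm F}$, and the smoothing function $\tilde w(X,\mu)=w(X)$ if $w(X)\ge\mu\rho$, $\tilde w(X,\mu)=\frac{w(X)^2}{2\mu\rho}+\frac{\mu\rho}{2}$ if $w(X)<\mu\rho$ ($\mu>0$). Writing $\mathrm{grad}\,\tilde w(X,\mu)$ for the Riemannian gradient of $\tilde w(\cdot,\mu)$, the smoothing subdifferential is $\partial_{\mathrm R}|_{\tilde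 w}w(X)=\{G\in\mathcal{T}_X\mathcal{O}^{d,r}:\mathrm{grad}\,\tilde w(X_t,\mu_t)\to G\text{ for some sequences }\mathcal{O}^{d,r}\ni X_t\to X,\ \mu_t\downarrow 0\}$. *)

(* Defs.v *)
From HB Require Import structures.
From mathcomp Require Import all_boot all_order all_algebra.
From mathcomp Require Import reals.
Set Implicit Arguments. Unset Strict Implicit. Unset Printing Implicit Defensive.
Import Order.TTheory GRing.Theory Num.Theory.
Local Open Scope ring_scope.

Section Defs.
Variable R : realType.
Variables d r : nat.

Definition finner {m n} (A B : 'M[R]_(m, n)) : R :=
  \sum_(i < m) \sum_(j < n) A i j * B i j.
Definition fnorm {m n} (A : 'M[R]_(m, n)) : R := Num.sqrt (finner A A).

Definition stiefel (X : 'M[R]_(d, r)) : Prop := X^T *m X = 1%:M.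

Definition tangent (X D : 'M[R]_(d, r)) : Prop := X^T *m D + D^T *m X = 0.

Definition proj_tangent (X V : 'M[R]_(d, r)) : 'M[R]_(d, r) :=
  V - X *m ((2%:R)^-1 *: (X^T *m V + V^T *m X)).

Definition mx_cvg {m n} (u : nat -> 'M[R]_(m, n)) (l : 'M[R]_(m, n)) : Prop :=
  forall eps : R, 0 < eps -> exists N : nat, forall t, (N <= t)%N -> fnorm (u t - l) < eps.

Definition seq_cvg (u : nat -> R) (l : R) : Prop :=
  forall eps : R, 0 < eps -> exists N : nat, forall t, (N <= t)%N -> `|u t - l| < eps.

Definition is_egrad (F : 'M[R]_(d, r) -> R) (X V : 'M[R]_(d, r)) : Prop :=
  forall eps : R, 0 < eps -> exists2 delta : R, 0 < delta &
    forall Y : 'M[R]_(d, r), fnorm (Y - X) < delta ->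
      `|F Y - F X - finner V (Y - X)| <= eps * fnorm (Y - X).

(* Riemannian gradient of F : O^{d,r} -> R at X (intrinsic, for F only defined
   on the manifold): G in T_X with F(Y) = F(X) + <G, Y - X> + o(|Y - X|), Y in O. *)
Definition is_rgrad (F : 'M[R]_(d, r) -> R) (X G : 'M[R]_(d, r)) : Prop :=
  tangent X G /\
  forall eps : R, 0 < eps -> exists2 delta : R, 0 < delta &
    forall Y : 'M[R]_(d, r), stiefel Y -> fnorm (Y - X) < delta ->
      `|F Y - F X - finner G (Y - X)| <= eps * fnorm (Y - X).

Definition conv_hull (S : 'M[R]_(d, r) -> Prop) (G : 'M[R]_(d, r)) : Prop :=
  exists (n : nat) (lam : 'I_n -> R) (P : 'I_n -> 'M[R]_(d, r)),
    [/\ forall i, 0 <= lam i, \sum_(i < n) lam i = 1, forall i, S (P i) &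
        G = \sum_(i < n) lam i *: P i].

Definition clarke_subdiff (F : 'M[R]_(d, r) -> R) (X : 'M[R]_(d, r)) : 'M[R]_(d, r) -> Prop :=
  conv_hull (fun D => tangent X D /\
    exists (Xs Gs : nat -> 'M[R]_(d, r)),
      [/\ forall t, stiefel (Xs t), forall t, is_rgrad F (Xs t) (Gs t),
          mx_cvg Xs X & mx_cvg Gs D]).

(* w(X) = 2 rho ||(I - X X^T) S||_F with S = Sigma^{1/2} *)
Definition wfun (S : 'M[R]_d) (rho : R) (X : 'M[R]_(d, r)) : R :=
  2%:R * rho * fnorm ((1%:M - X *m X^T) *m S).

Definition wtilde (S : 'M[R]_d) (rho : R) (X : 'M[R]_(d, r)) (mu : R) : R :=
  if mu * rho <= wfun S rho X then wfun S rho X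
  else (wfun S rho X) ^+ 2 / (2%:R * mu * rho) + mu * rho / 2%:R.

(* smoothing subdifferential: grad wtilde(., mu) = Proj_{T_X}(\nabla wtilde(., mu)) *)
Definition smoothing_subdiff (S : 'M[R]_d) (rho : R) (X G : 'M[R]_(d, r)) : Prop :=
  tangent X G /\
  exists (Xs Vs : nat -> 'M[R]_(d, r)) (mus : nat -> R),
    [/\ forall t, stiefel (Xs t), mx_cvg Xs X,
        [/\ forall t, 0 < mus t, forall t, mus t.+1 <= mus t & seq_cvg mus 0],
        forall t, is_egrad (fun Y => wtilde S rho Y (mus t)) (Xs t) (Vs t) &
        mx_cvg (fun t => proj_tangent (Xs t) (Vs t)) G].

End Defs.

Definition psd {R : realType} {d : nat} (A : 'M[R]_d) : Prop :=
  A^T = A /\ forall v : 'cV[R]_d, 0 <= (v^T *m A *m v) ord0 ord0.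

(* Main.v *)
(** The smoothing is a Huber-type function of [w], so at a point [Y] of the manifold the
    gradient of the smoothed function is [l * grad w(Y)] with [l = w(Y) / max(mu rho, w(Y))]
    in [0, 1] (and it vanishes with [w(Y)]). If [w(X) > 0], then [l = 1] eventually and [G]
    is itself a limit of gradients of [w]. If [w(X) = 0], compactness gives [G = l *: g]
    with [g] a limit of gradients of [w]; the reflection [Q = 2 X X^T - 1] fixes [X] and
    leaves [w] invariant, while [X^T g = 0], so that [Q g = - g] is another such limit and
    [l *: g] lies on the segment [[- g, g]]. *)
Require Import Defs.
From HB Require Import structures.
From mathcomp Require Import all_boot all_order all_algebra.
From mathcomp Require Import reals.
From mathcomp Require Import boolp classical_sets filter topology normedtype sequences.
From mathcomp Require Import ring lra.
Set Implicit Arguments. Unset Strict Implicit. Unset Printing Implicit Defensive.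
Import Order.TTheory GRing.Theory Num.Theory.
Import numFieldNormedType.Exports.
Local Open Scope ring_scope.

(** * The Frobenius inner product and norm *)

Section Frobenius.
Variable R : realType.
Implicit Types (m n p : nat).

Lemma finnerE m n (A B : 'M[R]_(m, n)) : finner A B = \tr (A^T *m B).
Proof.
rewrite /finner exchange_big; apply: eq_bigr => j _; rewrite mxE.
by apply: eq_bigr => i _; rewrite mxE.
Qed.

Lemma finnerC m n (A B : 'M[R]_(m, n)) : finner A B = finner B A.
Proof. by apply: eq_bigr => i _; apply: eq_bigr => j _; rewrite mulrC. Qed.

Lemma finnerDl m n (A B C : 'M[R]_(m, n)) :
  finner (A + B) C = finner A C + finner B C.
Proof. by rewrite !finnerE linearD mulmxDl linearD. Qed.

Lemma finnerZl m n a (A B : 'M[R]_(m, n)) : finner (a *: A) B = a * finner A B.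
Proof. by rewrite !finnerE linearZ -scalemxAl linearZ. Qed.

Lemma finnerDr m n (A B C : 'M[R]_(m, n)) :
  finner C (A + B) = finner C A + finner C B.
Proof. by rewrite !(finnerC C) finnerDl. Qed.

Lemma finnerZr m n a (A B : 'M[R]_(m, n)) : finner A (a *: B) = a * finner A B.
Proof. by rewrite !(finnerC A) finnerZl. Qed.

Lemma finnerNl m n (A B : 'M[R]_(m, n)) : finner (- A) B = - finner A B.
Proof. by rewrite -scaleN1r finnerZl mulN1r. Qed.

Lemma finnerNr m n (A B : 'M[R]_(m, n)) : finner A (- B) = - finner A B.
Proof. by rewrite -scaleN1r finnerZr mulN1r. Qed.

Lemma finner_ge0 m n (A : 'M[R]_(m, n)) : 0 <= finner A A.
Proof. by apply: sumr_ge0 => i _; apply: sumr_ge0 => j _; rewrite -expr2 sqr_ge0. Qed.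

Lemma fnorm_ge0 m n (A : 'M[R]_(m, n)) : 0 <= fnorm A.
Proof. exact: sqrtr_ge0. Qed.

Lemma sqr_fnorm m n (A : 'M[R]_(m, n)) : fnorm A ^+ 2 = finner A A.
Proof. by rewrite sqr_sqrtr ?finner_ge0. Qed.

Lemma fnorm_eq0 m n (A : 'M[R]_(m, n)) : (fnorm A == 0) = (A == 0).
Proof.
apply/eqP/eqP => [A0|->]; last first.
  by rewrite /fnorm -(scale0r 0) finnerZl mul0r sqrtr0.
have /eqP := sqr_fnorm A; rewrite A0 expr0n /= eq_sym /finner psumr_eq0; last first.
  by move=> i _; apply: sumr_ge0 => j _; rewrite -expr2 sqr_ge0.
move=> /allP A0'; apply/matrixP => i j; rewrite mxE.
have := A0' i (mem_index_enum _); rewrite psumr_eq0 /=; last first.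
  by move=> k _; rewrite -expr2 sqr_ge0.
by move=> /allP/(_ j (mem_index_enum _)); rewrite /= -expr2 expf_eq0 => /eqP.
Qed.

Lemma fnorm0 m n : fnorm (0 : 'M[R]_(m, n)) = 0.
Proof. by apply/eqP; rewrite fnorm_eq0. Qed.

Lemma fnormZ m n a (A : 'M[R]_(m, n)) : fnorm (a *: A) = `|a| * fnorm A.
Proof.
by rewrite /fnorm finnerZl finnerZr mulrA -expr2 sqrtrM ?sqr_ge0 // sqrtr_sqr.
Qed.

Lemma fnormN m n (A : 'M[R]_(m, n)) : fnorm (- A) = fnorm A.
Proof. by rewrite -scaleN1r fnormZ normrN1 mul1r. Qed.

Lemma fnorm_tr m n (A : 'M[R]_(m, n)) : fnorm A^T = fnorm A.
Proof. by rewrite /fnorm !finnerE mxtrace_mulC trmxK. Qed.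

(** Cauchy-Schwarz: with [a], [b], [c] as set in the proof, the squared norm of [b *: A - c *: B] is
    [b * (a * b - c ^+ 2)]. *)
Lemma finner_le m n (A B : 'M[R]_(m, n)) : `|finner A B| <= fnorm A * fnorm B.
Proof.
have h : finner A B ^+ 2 <= finner A A * finner B B.
  have [B0|B_neq0] := eqVneq (finner B B) 0.
    have /eqP : fnorm B = 0 by rewrite /fnorm B0 sqrtr0.
    by rewrite fnorm_eq0 => /eqP ->; rewrite -(scale0r 0) !finnerZr !mul0r expr0n /= mulr0.
  have B_gt0 : 0 < finner B B by rewrite lt_def B_neq0 finner_ge0.
  have := finner_ge0 (finner B B *: A - finner A B *: B).
  rewrite !(finnerDl, finnerDr, finnerZl, finnerZr, finnerNl, finnerNr) (finnerC B A).
  set a := finner A A; set b := finner B B; set c := finner A B => h.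
  rewrite -subr_ge0 -(pmulr_rge0 _ B_gt0) -/b.
  by apply: le_trans h _; rewrite le_eqVlt; apply/orP; left; apply/eqP; ring.
rewrite -(ler_pXn2r (n := 2)) ?nnegrE ?mulr_ge0 ?fnorm_ge0 //.
by rewrite exprMn !sqr_fnorm real_normK ?num_real.
Qed.

Lemma ler_fnormD m n (A B : 'M[R]_(m, n)) : fnorm (A + B) <= fnorm A + fnorm B.
Proof.
rewrite -(ler_pXn2r (n := 2)) ?nnegrE ?addr_ge0 ?fnorm_ge0 //.
rewrite sqr_fnorm finnerDl !finnerDr (finnerC B A) -!sqr_fnorm.
have := finner_le A B; have := ler_norm (finner A B); nra.
Qed.

Lemma fnormBC m n (A B : 'M[R]_(m, n)) : fnorm (A - B) = fnorm (B - A).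
Proof. by rewrite -fnormN opprB. Qed.

(** Each entry of the product pairs a row of [A] with a column of [B], so Cauchy-Schwarz applies
    entry by entry. *)
Lemma ler_fnormM m n p (A : 'M[R]_(m, n)) (B : 'M[R]_(n, p)) :
  fnorm (A *m B) <= fnorm A * fnorm B.
Proof.
rewrite -(ler_pXn2r (n := 2)) ?nnegrE ?mulr_ge0 ?fnorm_ge0 //.
rewrite exprMn !sqr_fnorm {1 2}/finner -(sqr_fnorm B) -(fnorm_tr B) sqr_fnorm /finner.
rewrite mulr_suml; apply: ler_sum => i _; rewrite mulr_sumr; apply: ler_sum => j _.
have row_col : (A *m B) i j = finner (row i A) (row j B^T).
  by rewrite mxE /finner big_ord1; apply: eq_bigr => k _; rewrite !mxE.
have sqr_row q (C : 'M[R]_(q, n)) k : \sum_l C k l * C k l = fnorm (row k C) ^+ 2.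
  by rewrite sqr_fnorm /finner big_ord1; apply: eq_bigr => l _; rewrite !mxE.
rewrite !sqr_row -expr2 row_col -exprMn -real_normK ?num_real //.
by rewrite ler_pXn2r ?nnegrE ?mulr_ge0 ?fnorm_ge0 ?finner_le.
Qed.

Lemma ler_norm_fnorm m n (A : 'M[R]_(m, n)) i j : `|A i j| <= fnorm A.
Proof.
rewrite -sqrtr_sqr ler_sqrt ?finner_ge0 // /finner (bigD1 i) //= (bigD1 j) //= -!addrA expr2.
rewrite lerDl addr_ge0 //; apply: sumr_ge0 => k _; rewrite -?expr2 ?sqr_ge0 //.
by apply: sumr_ge0 => l _; rewrite -expr2 sqr_ge0.
Qed.

(** Splitting along elementary matrices, of norm at most 1, turns entrywise limits into limits in
    norm. *)
Lemma fnorm_le_sum m n (A : 'M[R]_(m, n)) : fnorm A <= \sum_i \sum_j `|A i j|.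
Proof.
have sum_le k (I : 'I_k -> 'M[R]_(m, n)) : fnorm (\sum_i I i) <= \sum_i fnorm (I i).
  elim/big_ind2 : _ => [|A1 x A2 y h1 h2|i _]; rewrite ?fnorm0 //.
  exact: le_trans (ler_fnormD _ _) (lerD h1 h2).
rewrite {1}[A]matrix_sum_delta; apply: le_trans (sum_le _ _) (ler_sum _ _) => i _.
apply: le_trans (sum_le _ _) (ler_sum _ _) => j _; rewrite fnormZ ler_piMr //.
rewrite -(sqrtr1 R) ler_sqrt ?ler01 // /finner (bigD1 i) //= [X in _ + X]big1 => [|k /negPf ki].
  rewrite (bigD1 j) //= [X in _ + X + _]big1 => [|k /negPf kj].
    by rewrite !mxE !eqxx !addr0 mulr1.
  by rewrite !mxE kj andbF mul0r.
by apply: big1 => l _; rewrite !mxE ki mul0r.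
Qed.

End Frobenius.

(** * Euclidean and Riemannian gradients, with a chain rule *)

Section Gradients.
Variables (R : realType) (d r : nat).
Implicit Types (F f : 'M[R]_(d, r) -> R) (X Y V : 'M[R]_(d, r)).

Lemma is_egrad_quadratic F X V (K : R) :
  (forall Y, fnorm (Y - X) <= 1 ->
     `|F Y - F X - finner V (Y - X)| <= K * fnorm (Y - X) ^+ 2) ->
  is_egrad F X V.
Proof.
move=> FK eps eps_gt0; have K1_gt0 : 0 < `|K| + 1 by rewrite ltr_wpDl.
exists (Num.min 1 (eps / (`|K| + 1))); first by rewrite lt_min ltr01 divr_gt0.
move=> Y; rewrite lt_min ltr_pdivlMr // => /andP[/ltW h1 h2].
apply: le_trans (FK _ h1) _; rewrite expr2 mulrA ler_wpM2r ?fnorm_ge0 //.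
have := fnorm_ge0 (Y - X); have := ler_norm K; nra.
Qed.

(** A chain rule in which the outer function enters only through an expansion in increments of [F].
    Later [F] is the smooth square of [wfun], and [f] is [wfun] or its smoothing. *)
Lemma is_egrad_comp F f X V (a K : R) :
  is_egrad F X V ->
  (forall Y, `|f Y - f X - a * (F Y - F X)| <= K * (F Y - F X) ^+ 2) ->
  is_egrad f X (a *: V).
Proof.
move=> FV fK eps eps_gt0.
have a1_gt0 : 0 < `|a| + 1 by rewrite ltr_wpDl.
have [d1 d1_gt0 Fd1] := FV _ ltr01.
have e_gt0 : 0 < eps / 2 / (`|a| + 1) by rewrite !divr_gt0.
have [d2 d2_gt0 Fd2] := FV _ e_gt0.
(* [M] is the Lipschitz bound at [X] given by the expansion of [F] with tolerance 1. *)
set M := 1 + fnorm V; have M_ge0 : 0 <= M by rewrite addr_ge0 ?fnorm_ge0.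
have N_gt0 : 0 < `|K| * M ^+ 2 + 1 by rewrite ltr_wpDl // mulr_ge0 // sqr_ge0.
exists (Num.min d1 (Num.min d2 (eps / 2 / (`|K| * M ^+ 2 + 1)))).
  by rewrite !lt_min d1_gt0 d2_gt0 !divr_gt0.
move=> Y; rewrite !lt_min => /and3P[h1 h2]; rewrite ltr_pdivlMr // => h3.
set h := fnorm (Y - X) in h1 h2 h3 *; have h_ge0 : 0 <= h := fnorm_ge0 _.
have dF : `|F Y - F X| <= M * h.
  rewrite -[F Y - F X](subrK (finner V (Y - X))) (le_trans (ler_normD _ _)) //.
  by rewrite mulrDl lerD ?Fd1 ?finner_le.
have := fK Y; have := Fd2 _ h2; rewrite finnerZl -/h.
set x := F Y - F X in dF *; set v := finner _ _ => Fx fx.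
have -> : f Y - f X - a * v = (f Y - f X - a * x) + a * (x - v) by ring.
rewrite (le_trans (ler_normD _ _)) // [eps]splitr mulrDl lerD //.
  apply: le_trans fx _; apply: (@le_trans _ _ (`|K| * (M * h) ^+ 2)).
    rewrite -(real_normK (num_real x)).
    apply: (le_trans (ler_wpM2r (sqr_ge0 _) (ler_norm K))).
    by rewrite ler_wpM2l // ler_pXn2r ?nnegrE ?mulr_ge0.
  by have := ltW h3; have := normr_ge0 K; nra.
rewrite normrM; apply: (@le_trans _ _ (`|a| * (eps / 2 / (`|a| + 1) * h))).
  by rewrite ler_wpM2l.
rewrite mulrA ler_wpM2r // mulrCA -[leRHS]mulr1 ler_wpM2l //; first by rewrite divr_ge0 ?ltW.
by rewrite ler_pdivrMr // mul1r lerDl.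
Qed.

Lemma is_egrad_unique F X V V' : is_egrad F X V -> is_egrad F X V' -> V = V'.
Proof.
move=> FV FV'; apply/eqP; rewrite -subr_eq0 -fnorm_eq0 eq_le fnorm_ge0 andbT.
set D := V - V'; apply/ler_addgt0Pr => eps eps_gt0; rewrite add0r.
have eps2_gt0 : 0 < eps / 2 by rewrite divr_gt0.
have [d1 d1_gt0 h1] := FV _ eps2_gt0; have [d2 d2_gt0 h2] := FV' _ eps2_gt0.
rewrite leNgt; apply/negP => epsD; have D_gt0 := lt_trans eps_gt0 epsD.
(* The step [t *: D] has half the smaller radius as its length, so both expansions apply at the same
   point. *)
set t := Num.min d1 d2 / (fnorm D) / 2.
have min_gt0 : 0 < Num.min d1 d2 by rewrite lt_min d1_gt0.
have t_gt0 : 0 < t by rewrite !divr_gt0.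
have XtD : X + t *: D - X = t *: D by rewrite addrC addKr.
have tD : fnorm (X + t *: D - X) = t * fnorm D by rewrite XtD fnormZ gtr0_norm.
have tDmin : t * fnorm D < Num.min d1 d2.
  by rewrite /t mulrAC divfK ?gt_eqF // ltr_pdivrMr // ltr_pMr // ltr1n.
move: (tDmin); rewrite lt_min => /andP[td1 td2].
have := h1 (X + t *: D); have := h2 (X + t *: D); rewrite !tD => /(_ td2) + /(_ td1).
rewrite XtD !finnerZr.
have : t * finner V D - t * finner V' D = t * fnorm D ^+ 2.
  by rewrite sqr_fnorm {1}/D finnerDl finnerNl mulrBr.
rewrite !ler_norml => VD /andP[a1 a2] /andP[b1 b2].
have : t * fnorm D * fnorm D <= t * fnorm D * eps by rewrite -mulrA -expr2 -VD; lra.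
by apply/negP; rewrite -ltNge ltr_pM2l // mulr_gt0.
Qed.

Lemma is_rgrad_egrad F X V : tangent X V -> is_egrad F X V -> is_rgrad F X V.
Proof.
move=> XV FV; split=> // eps /FV[delta delta_gt0 Fdelta].
by exists delta => // Y _ /Fdelta.
Qed.

Lemma proj_tangent_id X V : tangent X V -> proj_tangent X V = V.
Proof. by rewrite /proj_tangent => ->; rewrite scaler0 mulmx0 subr0. Qed.

(** The second summand is the transpose of the first. The gradients below are tangent in this
    stronger sense. *)
Lemma tangent_horizontal X V : X^T *m V = 0 -> tangent X V.
Proof. by move=> XV; rewrite /tangent -[V^T *m X]trmxK trmx_mul trmxK XV trmx0 addr0. Qed.

End Gradients.

(** * The gradient of the squared norm of the residual *)

Section Residual.
Variables (R : realType) (d r : nat) (S : 'M[R]_d).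
Hypothesis S_sym : S^T = S.
Implicit Types (X Y H : 'M[R]_(d, r)).

Definition resid Y : 'M[R]_d := (1%:M - Y *m Y^T) *m S.

Lemma residD X H :
  resid (X + H) = resid X - ((X *m H^T + H *m X^T) *m S + H *m H^T *m S).
Proof.
rewrite /resid linearD /= -mulmxDl -mulmxBl [(X + H) *m _]mulmxDl !mulmxDr.
by congr (_ *m S); rewrite !opprD !addrA.
Qed.

(** The part of the increment linear in [H] is paired with [resid X], and cyclicity of the trace
    isolates [H]. The formula also holds off the manifold. *)
Lemma is_egrad_sqr_resid X :
  is_egrad (fun Y => fnorm (resid Y) ^+ 2) X
    (- 2 *: (resid X *m S *m X + S *m (resid X)^T *m X)).
Proof.
(* The first summand bounds the pairing of [resid X] with the quadratic part of the increment, the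
   second the squared norm of the whole increment when [fnorm H <= 1]. *)
pose K := 2 * fnorm (resid X) * fnorm S + (2 * fnorm X * fnorm S + fnorm S) ^+ 2.
apply: (@is_egrad_quadratic _ _ _ _ _ _ K) => Y.
have -> : resid Y = resid (X + (Y - X)) by rewrite addrC subrK.
rewrite residD; set H := Y - X => h1; set E := resid X.
set L := (_ + _) *m S; set Q := H *m H^T *m S.
have EL A : finner A L = finner (A *m S *m X + S *m A^T *m X) H.
  rewrite /L mulmxDl finnerDr finnerDl addrC; congr (_ + _).
    rewrite !finnerE !trmx_mul S_sym !mulmxA.
    by rewrite -(mulmxA (A^T *m H)) mxtrace_mulC !mulmxA.
  rewrite [RHS]finnerC !finnerE !mulmxA.
  by rewrite -(mulmxA (A^T *m X)) mxtrace_mulC !mulmxA.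
have Lh : fnorm L <= 2 * fnorm X * fnorm S * fnorm H.
  rewrite (le_trans (ler_fnormM _ _)) // mulrAC ler_wpM2r ?fnorm_ge0 //.
  rewrite (le_trans (ler_fnormD _ _)) //.
  rewrite (_ : 2 * _ * _ = fnorm X * fnorm H^T + fnorm H * fnorm X^T).
    by rewrite lerD ?ler_fnormM.
  by rewrite !fnorm_tr; ring.
have Qh : fnorm Q <= fnorm S * fnorm H ^+ 2.
  rewrite (le_trans (ler_fnormM _ _)) // mulrC ler_wpM2l ?fnorm_ge0 //.
  by rewrite (le_trans (ler_fnormM _ _)) // fnorm_tr expr2.
move: (fnorm H) (fnorm_ge0 H) h1 Lh Qh => h h_ge0 h1 Lh Qh.
rewrite finnerZl -EL !sqr_fnorm.
have := finnerDr L Q E; set T := L + Q => ET.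
rewrite finnerDl finnerNl !finnerDr !finnerNr (finnerC T E) ET -(sqr_fnorm T).
rewrite [X in `|X|](_ : _ = fnorm T ^+ 2 - 2 * finner E Q); last by ring.
rewrite (le_trans (ler_normB _ _)) // addrC /K [leRHS]mulrDl; apply: lerD.
  rewrite normrM ger0_norm ?ler0n // -!mulrA ler_wpM2l ?ler0n //.
  by rewrite (le_trans (finner_le _ _)) // ler_wpM2l ?fnorm_ge0.
rewrite ger0_norm ?sqr_ge0 // -exprMn.
rewrite ler_pXn2r ?nnegrE ?mulr_ge0 ?addr_ge0 ?mulr_ge0 ?fnorm_ge0 //.
rewrite (le_trans (ler_fnormD _ _)) // mulrDl lerD // (le_trans Qh) //.
by rewrite ler_wpM2l ?fnorm_ge0 // expr2 ler_piMl.
Qed.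

(** On the manifold [1%:M - X *m X^T] projects onto the orthogonal complement of the columns of [X].
    This makes gradients horizontal; the transposed identity removes the second summand of the
    gradient above. *)
Lemma stiefel_resid X : stiefel X -> X^T *m resid X = 0.
Proof. by move=> XX; rewrite /resid mulmxA mulmxBr mulmx1 mulmxA XX mul1mx subrr mul0mx. Qed.

Lemma stiefel_residT X : stiefel X -> (resid X)^T *m X = 0.
Proof. by move=> XX; rewrite -[LHS]trmxK trmx_mul trmxK stiefel_resid ?trmx0. Qed.

End Residual.

(** * Expansions of the Huber function and of the identity in the squared variable *)

Section Huber.
Variable R : realFieldType.
Implicit Types c s : R.

(** [wtilde S rho Y mu] is the value of [huber (mu * rho)] at [wfun S rho Y]. *)
Definition huber c s : R := if c <= s then s else s ^+ 2 / (2 * c) + c / 2.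

(* As a function of [s ^+ 2], [huber c] is differentiable with derivative
   [(2 * max c s)^-1], also at the junction [s = c]. *)
Lemma huber_sqr_expansion c s s0 : 0 < c -> 0 <= s -> 0 <= s0 ->
  `|huber c s - huber c s0 - (2 * Num.max c s0)^-1 * (s ^+ 2 - s0 ^+ 2)|
    <= (2 * c ^+ 3)^-1 * (s ^+ 2 - s0 ^+ 2) ^+ 2.
Proof.
move=> c_gt0 s_ge0 s0_ge0; rewrite /huber; set b := (2 * c ^+ 3)^-1 * _.
have c3_gt0 : 0 < 2 * c ^+ 3 by rewrite mulr_gt0 ?exprn_gt0.
(* In each of the four cases the error is a nonpositive fraction [- (n / q)]; clearing denominators
   leaves a polynomial inequality. *)
suff bound x y n q : x = - (n / q) -> y = b -> 0 <= n -> 0 < q ->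
    2 * c ^+ 3 * n <= (s ^+ 2 - s0 ^+ 2) ^+ 2 * q -> `|x| <= y.
  case: (leP c s0) => [cs0|s0c]; case: (leP c s) => [cs|sc].
  - have s0_gt0 := lt_le_trans c_gt0 cs0.
    apply: (bound _ _ ((s - s0) ^+ 2) (2 * s0)) => //; rewrite ?sqr_ge0 ?mulr_gt0 //.
      by field; rewrite gt_eqF.
    rewrite (_ : _ * (2 * s0) = 2 * (s0 * (s + s0) ^+ 2) * (s - s0) ^+ 2); last by ring.
    by rewrite ler_wpM2r ?sqr_ge0 // ler_wpM2l // exprS ler_pM ?sqr_ge0 ?(ltW c_gt0) //; nra.
  - have s0_gt0 := lt_le_trans c_gt0 cs0.
    apply: (bound _ _ ((s0 - c) * (c * s0 - s ^+ 2)) (2 * c * s0)) => //.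
    + by field; rewrite !gt_eqF.
    + by rewrite mulr_ge0 ?subr_ge0 //; nra.
    + by rewrite !mulr_gt0.
    rewrite (_ : 2 * c ^+ 3 * _ = 2 * c * ((c ^+ 2 * (s0 - c)) * (c * s0 - s ^+ 2))); last by ring.
    rewrite [leRHS](_ : _ = 2 * c * ((s0 * (s0 + s) * (s0 - s)) * (s0 ^+ 2 - s ^+ 2)));
      last by ring.
    (* Both sides are now products of nonnegative factors, compared pairwise. *)
    have u_ge0 : 0 <= c ^+ 2 * (s0 - c) by rewrite mulr_ge0 ?sqr_ge0 ?subr_ge0.
    have v_ge0 : 0 <= c * s0 - s ^+ 2 by nra.
    have uU : c ^+ 2 * (s0 - c) <= s0 * (s0 + s) * (s0 - s).
      rewrite ler_pM ?sqr_ge0 ?subr_ge0 //; last by lra.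
      by nra.
    have vV : c * s0 - s ^+ 2 <= s0 ^+ 2 - s ^+ 2 by rewrite lerB // expr2 ler_wpM2r.
    by rewrite ler_wpM2l ?mulr_ge0 ?(ltW c_gt0) // ler_pM.
  - apply: (bound _ _ ((s - c) ^+ 2) (2 * c)) => //; rewrite ?sqr_ge0 ?mulr_gt0 //.
      by field; rewrite gt_eqF.
    rewrite (_ : 2 * _ * _ = 2 * c * (c * (s - c)) ^+ 2); last by ring.
    rewrite mulrC ler_wpM2r ?mulr_ge0 ?(ltW c_gt0) //.
    have sc_ge0 : 0 <= c * (s - c) by rewrite mulr_ge0 ?subr_ge0 // ltW.
    have le_sc : c * (s - c) <= s ^+ 2 - s0 ^+ 2 by nra.
    by rewrite ler_pXn2r ?nnegrE // (le_trans sc_ge0).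
  - apply: (bound _ _ 0 1) => //; last by rewrite mulr0 mulr1 sqr_ge0.
    by field; rewrite gt_eqF.
move=> -> -> n_ge0 q_gt0 h; rewrite normrN ger0_norm ?divr_ge0 ?(ltW q_gt0) //.
by rewrite ler_pdivrMr // /b -mulrA ler_pdivlMl.
Qed.

(** The error is exactly [- (s - s0) ^+ 2 / (2 * s0)], and [s0 <= s + s0] bounds it. This expands
    the square root of [s ^+ 2] away from zero. *)
Lemma sqr_expansion s s0 : 0 < s0 -> 0 <= s ->
  `|s - s0 - (2 * s0)^-1 * (s ^+ 2 - s0 ^+ 2)|
    <= (2 * s0 ^+ 3)^-1 * (s ^+ 2 - s0 ^+ 2) ^+ 2.
Proof.
move=> s0_gt0 s_ge0.
have -> : s - s0 - (2 * s0)^-1 * (s ^+ 2 - s0 ^+ 2) =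
    - ((2 * s0 ^+ 3)^-1 * (s0 * (s - s0)) ^+ 2) by field; rewrite gt_eqF.
have K_ge0 : 0 <= (2 * s0 ^+ 3)^-1.
  by rewrite invr_ge0 mulr_ge0 // exprn_ge0 // ltW.
rewrite normrN ger0_norm; last by apply: mulr_ge0; rewrite // sqr_ge0.
rewrite ler_wpM2l // subr_sqr [s0 * _]mulrC !exprMn.
by rewrite ler_wpM2l ?sqr_ge0 // ler_pXn2r ?nnegrE ?addr_ge0 ?(ltW s0_gt0) // lerDr.
Qed.

End Huber.

(** * Limits of matrix sequences and compactness *)

Section Convergence.
Variable R : realType.
Implicit Types (m n p : nat).

(** Reindexings are only asked to satisfy [k <= f k], which preserves limits and is stable under
    composition. *)
Lemma mx_cvg_sub m n (u : nat -> 'M[R]_(m, n)) l (f : nat -> nat) :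
  (forall k, (k <= f k)%N) -> mx_cvg u l -> mx_cvg (u \o f) l.
Proof.
move=> fk ul eps /ul[N uN]; exists N => t Nt.
exact/uN/(leq_trans Nt)/fk.
Qed.

Lemma mx_cvg_cst m n (A : 'M[R]_(m, n)) : mx_cvg (fun=> A) A.
Proof. by move=> eps eps_gt0; exists 0 => t _; rewrite subrr fnorm0. Qed.

Lemma mx_cvg_eventually m n (u v : nat -> 'M[R]_(m, n)) l N :
  (forall t, (N <= t)%N -> u t = v t) -> mx_cvg u l -> mx_cvg v l.
Proof.
move=> uv ul eps /ul[N' uN]; exists (maxn N N') => t.
by rewrite geq_max => /andP[Nt N't]; rewrite -uv // uN.
Qed.

Lemma mx_cvg_unique m n (u : nat -> 'M[R]_(m, n)) l l' :
  mx_cvg u l -> mx_cvg u l' -> l = l'.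
Proof.
move=> ul ul'; apply/eqP; rewrite -subr_eq0 -fnorm_eq0 eq_le fnorm_ge0 andbT.
apply/ler_addgt0Pr => eps eps_gt0; rewrite add0r.
have e2 : 0 < eps / 2 by rewrite divr_gt0.
have [N uN] := ul _ e2; have [N' uN'] := ul' _ e2.
have {uN} := uN _ (leq_maxl N N'); have {uN'} := uN' _ (leq_maxr N N').
set v := u _; rewrite (fnormBC v l) => h1 h2.
rewrite (_ : l - l' = (l - v) + (v - l')); last by rewrite addrA subrK.
by apply: le_trans (ler_fnormD _ _) _; rewrite [eps]splitr lerD // ltW.
Qed.

Lemma mx_cvg_bounded m n (u : nat -> 'M[R]_(m, n)) l :
  mx_cvg u l -> exists N, forall t, (N <= t)%N -> fnorm (u t) <= fnorm l + 1.
Proof.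
move=> /(_ _ ltr01)[N uN]; exists N => t /uN /ltW h.
by rewrite -[u t](subrK l) (le_trans (ler_fnormD _ _)) // addrC lerD2l.
Qed.

Lemma mx_cvgM m n p (u : nat -> 'M[R]_(m, n)) (v : nat -> 'M[R]_(n, p)) a b :
  mx_cvg u a -> mx_cvg v b -> mx_cvg (fun t => u t *m v t) (a *m b).
Proof.
move=> ua vb eps eps_gt0.
have [N0 uN0] := mx_cvg_bounded ua.
have a_gt0 : 0 < fnorm a + 1 by rewrite ltr_wpDl ?fnorm_ge0.
have b_gt0 : 0 < fnorm b + 1 by rewrite ltr_wpDl ?fnorm_ge0.
have ea : 0 < eps / 2 / (fnorm b + 1) by rewrite !divr_gt0.
have eb : 0 < eps / 2 / (fnorm a + 1) by rewrite !divr_gt0.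
have [N1 uN1] := ua _ ea; have [N2 vN2] := vb _ eb.
exists (maxn N0 (maxn N1 N2)) => t; rewrite !geq_max => /and3P[/uN0 h0 /uN1 h1 /vN2 h2].
have -> : u t *m v t - a *m b = u t *m (v t - b) + (u t - a) *m b.
  by rewrite mulmxBr mulmxBl addrA subrK.
apply: le_lt_trans (ler_fnormD _ _) _; rewrite [eps]splitr ltrD //.
  apply: le_lt_trans (ler_fnormM _ _) _.
  by move: h2; rewrite ltr_pdivlMr // mulrC; apply: le_lt_trans; rewrite ler_wpM2r ?fnorm_ge0.
apply: le_lt_trans (ler_fnormM _ _) _.
move: h1; rewrite ltr_pdivlMr //; apply: le_lt_trans.
by rewrite ler_wpM2l ?fnorm_ge0 // lerDl.
Qed.

Lemma mx_cvg_tr m n (u : nat -> 'M[R]_(m, n)) a :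
  mx_cvg u a -> mx_cvg (fun t => (u t)^T) a^T.
Proof.
move=> ua eps /ua[N uN]; exists N => t /uN.
by rewrite -[_^T - _]linearB fnorm_tr.
Qed.

Lemma mx_cvgZ m n (x : nat -> R) l (u : nat -> 'M[R]_(m, n)) a :
  seq_cvg x l -> mx_cvg u a -> mx_cvg (fun t => x t *: u t) (l *: a).
Proof.
move=> xl ua.
(* Scaling is multiplication by a scalar matrix, so the limit of products applies. *)
suff xI : mx_cvg (fun t => (x t)%:M : 'M_m) l%:M.
  have := mx_cvgM xI ua; rewrite mul_scalar_mx.
  by apply: (@mx_cvg_eventually _ _ _ _ _ 0) => t _; rewrite mul_scalar_mx.
move=> eps eps_gt0; pose I := fnorm (1%:M : 'M[R]_m).
have I_gt0 : 0 < I + 1 by rewrite ltr_wpDl ?fnorm_ge0.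
have [N xN] := xl _ (divr_gt0 eps_gt0 I_gt0); exists N => t /xN.
have -> : (x t)%:M - l%:M = (x t - l) *: (1%:M : 'M_m) by rewrite scalerBl !scalemx1.
rewrite ltr_pdivlMr // fnormZ; apply: le_lt_trans.
by rewrite ler_wpM2l // lerDl.
Qed.

Lemma bounded_seq_subcvg (u : nat -> R) M : (forall t, `|u t| <= M) ->
  exists (f : nat -> nat) (l : R), (forall k, (k <= f k)%N) /\ seq_cvg (u \o f) l.
Proof.
move=> uM; have [|f f_inc /cvg_ex[/= l ul]] := bolzano_weierstrass (u_ := u).
  exists M; split; first exact: num_real.
  by move=> x Mx y _ /=; apply: le_trans (uM y) (ltW Mx).
have f_homo : {homo f : i j / (i < j)%N}.
  by move=> i j; rewrite !ltnNge; apply: contra => ji; rewrite -f_inc.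
exists f, l; split => //.
  by elim=> // k IHk; apply: leq_ltn_trans IHk _; exact: f_homo.
move=> eps eps_gt0.
have /cvgrPdistC_lt/(_ _ eps_gt0) := ul.
by move=> [N _ uN]; exists N => t Nt; apply: uN.
Qed.

Lemma seq_cvg_sub (u : nat -> R) l (f : nat -> nat) :
  (forall k, (k <= f k)%N) -> seq_cvg u l -> seq_cvg (u \o f) l.
Proof.
by move=> fk ul eps /ul[N uN]; exists N => t Nt; apply/uN/(leq_trans Nt)/fk.
Qed.

(** Successive extraction along [s]; limits already obtained survive further reindexing. *)
Lemma bounded_family_subcvg (I : eqType) (s : seq I) (u : nat -> I -> R) M :
  (forall t i, `|u t i| <= M) ->
  exists f : nat -> nat, (forall k, (k <= f k)%N) /\
    forall i, i \in s -> exists l, seq_cvg (fun t => u (f t) i) l.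
Proof.
move=> uM; elim: s => [|i s [f [fk fs]]]; first by exists id.
have [g [l [gk gl]]] := bounded_seq_subcvg (fun t => uM (f t) i).
exists (f \o g); split=> [k|j]; first exact: leq_trans (gk k) (fk _).
rewrite inE => /predU1P[->|/fs[l' fl']]; first by exists l.
by exists l'; exact: (seq_cvg_sub gk fl').
Qed.

Lemma mx_cvg_entrywise m n (u : nat -> 'M[R]_(m, n)) (l : 'M[R]_(m, n)) :
  (forall i j, seq_cvg (fun t => u t i j) (l i j)) -> mx_cvg u l.
Proof.
move=> ul eps eps_gt0.
(* The added 1 keeps the divisor positive for empty matrices and makes the final bound strict. *)
have mn_gt0 : 0 < (m * n)%:R + 1 :> R by rewrite ltr_wpDl.
have e_gt0 : 0 < eps / ((m * n)%:R + 1) by rewrite divr_gt0.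
have /choice[N uN] (k : 'I_m * 'I_n) : exists N, forall t, (N <= t)%N ->
    `|u t k.1 k.2 - l k.1 k.2| < eps / ((m * n)%:R + 1) by exact: ul.
exists (\max_k N k) => t Nt; apply: le_lt_trans (fnorm_le_sum _) _.
rewrite pair_big /=; apply: (@le_lt_trans _ _ (\sum_(k : 'I_m * 'I_n) (eps / ((m * n)%:R + 1)))).
  apply: ler_sum => k _; rewrite !mxE; apply/ltW/uN.
  by apply: leq_trans Nt; exact: leq_bigmax.
rewrite sumr_const card_prod !card_ord -[ltLHS]mulr_natr mulrAC ltr_pdivrMr //.
by rewrite ltr_pM2l // ltrDl.
Qed.

Lemma bounded_mx_subcvg m n (u : nat -> 'M[R]_(m, n)) M :
  (forall t, fnorm (u t) <= M) ->
  exists (f : nat -> nat) (l : 'M[R]_(m, n)),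
    (forall k, (k <= f k)%N) /\ mx_cvg (u \o f) l.
Proof.
move=> uM.
have [f [fk fl]] := @bounded_family_subcvg _ (enum {: 'I_m * 'I_n})
  (fun t k => u t k.1 k.2) M (fun t k => le_trans (ler_norm_fnorm _ _ _) (uM t)).
have /choice[l ul] (k : 'I_m * 'I_n) : exists l, seq_cvg (fun t => u (f t) k.1 k.2) l.
  by apply: fl; rewrite mem_enum.
exists f, (\matrix_(i, j) l (i, j)); split => //; apply: mx_cvg_entrywise => i j.
by rewrite mxE; exact: (ul (i, j)).
Qed.

End Convergence.

(** * Segments and points in convex hulls *)

Section ConvexHull.
Variables (R : realType) (d r : nat) (P : 'M[R]_(d, r) -> Prop).
Implicit Types A B : 'M[R]_(d, r).

Lemma conv_hull_segment A B a b :
  P A -> P B -> 0 <= a -> 0 <= b -> a + b = 1 -> conv_hull P (a *: A + b *: B).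
Proof.
move=> PA PB a_ge0 b_ge0 ab.
exists 2, (fun i => if i == ord0 then a else b), (fun i => if i == ord0 then A else B).
split=> [i||i|]; rewrite ?big_ord_recl ?big_ord0 ?addr0 //=; by case: ifP.
Qed.

Lemma conv_hull_mem A : P A -> conv_hull P A.
Proof.
move=> PA; rewrite -[A]scale1r -[_ *: _]addr0 -(scale0r A).
by apply: conv_hull_segment; rewrite ?addr0 ?ler01.
Qed.

End ConvexHull.

(** * Gradients of [wfun] and of its smoothing *)

Section WGradient.
Variables (R : realType) (d r : nat) (S : 'M[R]_d) (rho : R).
Hypotheses (S_sym : S^T = S) (rho_gt0 : 0 < rho).
Implicit Types X Y : 'M[R]_(d, r).
Local Notation w := (@wfun R d r S rho).

(** On the manifold this is the gradient of [wfun] where the residual is nonzero. Where the residual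
    vanishes it is 0, whatever the division returns. *)
Definition wgrad Y : 'M[R]_(d, r) :=
  - (2 * rho / fnorm (resid S Y)) *: (resid S Y *m S *m Y).

Lemma wgrad_resid0 Y : resid S Y = 0 -> wgrad Y = 0.
Proof. by move=> Y0; rewrite /wgrad Y0 !mul0mx scaler0. Qed.

Lemma wgrad_horizontal Y : stiefel Y -> Y^T *m wgrad Y = 0.
Proof.
move=> YY; rewrite /wgrad -scalemxAr -mulmxA (mulmxA Y^T) stiefel_resid //.
by rewrite mul0mx scaler0.
Qed.

Lemma fnorm_resid_gt0 Y : resid S Y != 0 -> 0 < fnorm (resid S Y).
Proof. by move=> Y0; rewrite lt_def fnorm_eq0 Y0 fnorm_ge0. Qed.

Lemma wfun_ge0 Y : 0 <= w Y.
Proof. by rewrite mulr_ge0 ?fnorm_ge0 // mulr_ge0 // ltW. Qed.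

Lemma is_egrad_sqr_wfun X : stiefel X ->
  is_egrad (fun Y => w Y ^+ 2) X (- (8 * rho ^+ 2) *: (resid S X *m S *m X)).
Proof.
(* The outer function is linear with slope [(2 * rho) ^+ 2], hence [K = 0]. *)
move=> XX; have := is_egrad_comp (is_egrad_sqr_resid S_sym X) (f := fun Y => w Y ^+ 2)
  (a := 4 * rho ^+ 2) (K := 0).
rewrite -!mulmxA stiefel_residT // mulmx0 addr0 scalerA !mulmxA.
rewrite (_ : 4 * rho ^+ 2 * -2 = - (8 * rho ^+ 2)); last by ring.
apply=> Y; rewrite mul0r normr_le0; apply/eqP.
by rewrite /wfun -/(resid S Y) -/(resid S X); ring.
Qed.

(** [w] is the square root of its smooth square, which is positive at [X]. *)
Lemma is_rgrad_wfun X : stiefel X -> resid S X != 0 -> is_rgrad w X (wgrad X).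
Proof.
move=> XX X0; have E_gt0 := fnorm_resid_gt0 X0.
have wX_gt0 : 0 < w X by rewrite !mulr_gt0.
apply: is_rgrad_egrad; first exact/tangent_horizontal/wgrad_horizontal.
have := is_egrad_comp (is_egrad_sqr_wfun XX) (fun Y => sqr_expansion wX_gt0 (wfun_ge0 Y)).
rewrite scalerA (_ : _ * - _ = - (2 * rho / fnorm (resid S X))) //.
by rewrite /wfun -/(resid S X); field; rewrite !gt_eqF.
Qed.

(** The smoothing is differentiated through [w ^+ 2], which is smooth even where [w] vanishes. *)
Lemma is_egrad_wtilde X mu : stiefel X -> 0 < mu ->
  is_egrad (fun Y => wtilde S rho Y mu) X ((w X / Num.max (mu * rho) (w X)) *: wgrad X).
Proof.
move=> XX mu_gt0; have c_gt0 : 0 < mu * rho by rewrite mulr_gt0.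
have -> : (fun Y => wtilde S rho Y mu) = (fun Y => huber (mu * rho) (w Y)).
  by apply: funext => Y; rewrite /wtilde /huber !mulrA.
have := is_egrad_comp (is_egrad_sqr_wfun XX)
  (fun Y => huber_sqr_expansion c_gt0 (wfun_ge0 Y) (wfun_ge0 X)).
have m_gt0 : 0 < Num.max (mu * rho) (w X) by rewrite lt_max c_gt0.
have [X0|X0] := eqVneq (resid S X) 0.
  by rewrite (wgrad_resid0 X0) X0 !mul0mx !scaler0.
have E_gt0 := fnorm_resid_gt0 X0.
move: m_gt0; set m := Num.max _ _ => m_gt0.
rewrite !scalerA (_ : _ * - (8 * _) = w X / m * - (2 * rho / fnorm (resid S X))) //.
by rewrite /wfun -/(resid S X); field; rewrite !gt_eqF.
Qed.

(** The residual norm cancels and [fnorm Y] is the square root of [r] on the manifold. This uniform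
    bound provides the compactness of gradients. *)
Lemma fnorm_wgrad_le Y : stiefel Y ->
  fnorm (wgrad Y) <= 2 * rho * (fnorm S * Num.sqrt r%:R).
Proof.
move=> YY; have rho2_ge0 : 0 <= 2 * rho by rewrite mulr_ge0 // ltW.
have [Y0|Y0] := eqVneq (resid S Y) 0.
  by rewrite wgrad_resid0 // fnorm0 mulr_ge0 // mulr_ge0 ?fnorm_ge0 ?sqrtr_ge0.
have E_gt0 := fnorm_resid_gt0 Y0.
rewrite fnormZ normrN ger0_norm ?divr_ge0 ?fnorm_ge0 // -[leLHS]mulrA ler_wpM2l //.
rewrite ler_pdivrMl // -mulmxA (le_trans (ler_fnormM _ _)) // ler_wpM2l ?fnorm_ge0 //.
rewrite (le_trans (ler_fnormM _ _)) // ler_wpM2l ?fnorm_ge0 //.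
by rewrite /fnorm finnerE YY mxtrace1.
Qed.

Lemma mx_cvg_resid (Xs : nat -> 'M[R]_(d, r)) X :
  mx_cvg Xs X -> mx_cvg (fun t => resid S (Xs t)) (resid S X).
Proof.
move=> XsX eps eps_gt0.
have [N cvN] := mx_cvgM (mx_cvgM XsX (mx_cvg_tr XsX)) (mx_cvg_cst S) eps_gt0.
exists N => t /cvN; rewrite fnormBC; congr (fnorm _ < _).
by rewrite /resid -!mulmxBl opprB [1%:M - _ + _]addrC addrA subrK.
Qed.

(** * Reflection symmetry of [wfun] at one of its zeros *)

Section Reflection.
Variable X : 'M[R]_(d, r).
Hypotheses (XX : stiefel X) (X0 : resid S X = 0).

(** The orthogonal reflection fixing the column space of [X] and negating its orthogonal
    complement. *)
Definition reflect_mx : 'M[R]_d := 2 *: (X *m X^T) - 1%:M.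
Local Notation Q := reflect_mx.

Lemma reflect_mx_sym : Q^T = Q.
Proof. by rewrite /Q linearB linearZ /= trmx_mul trmxK trmx1. Qed.

Lemma reflect_mx_fix : Q *m X = X.
Proof.
rewrite /Q mulmxBl -scalemxAl -mulmxA XX mulmx1 mul1mx.
by rewrite scaler_nat mulr2n addrK.
Qed.

Lemma reflect_mxK : Q *m Q = 1%:M.
Proof.
rewrite {2}/Q mulmxBr mulmx1 -scalemxAr mulmxA reflect_mx_fix /Q opprB addrC subrK.
by [].
Qed.

(** A zero residual at [X] puts the columns of [S] in the column space of [X], where [Q] is the
    identity. *)
Lemma reflect_mx_S : Q *m S = S.
Proof.
have XS : X *m X^T *m S = S.
  by apply/esym/eqP; rewrite -subr_eq0 -{1}[S]mul1mx -mulmxBl; apply/eqP.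
by rewrite /Q mulmxBl -scalemxAl XS mul1mx scaler_nat mulr2n addrK.
Qed.

Lemma reflect_S_mx : S *m Q = S.
Proof. by rewrite -[LHS]trmxK trmx_mul reflect_mx_sym S_sym reflect_mx_S S_sym. Qed.

Lemma stiefel_reflect Y : stiefel Y -> stiefel (Q *m Y).
Proof.
by move=> YY; rewrite /stiefel trmx_mul reflect_mx_sym mulmxA -(mulmxA _ Q Q) reflect_mxK mulmx1.
Qed.

(** The right factor [Q] is absorbed by [S], and [S = Q *m S] lets [Q] come out on the left. As [Q]
    is orthogonal, [w] is invariant. *)
Lemma resid_reflect Y : resid S (Q *m Y) = Q *m resid S Y.
Proof.
move: reflect_mx reflect_mx_sym reflect_mx_S => P PT PS.
rewrite /resid trmx_mul PT !(mulmxBl, mulmxBr) !mul1mx PS; congr (_ - _).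
by rewrite -!mulmxA PS.
Qed.

Lemma fnorm_reflect n (A : 'M[R]_(d, n)) : fnorm (Q *m A) = fnorm A.
Proof.
by rewrite /fnorm !finnerE trmx_mul reflect_mx_sym mulmxA -(mulmxA _ Q Q) reflect_mxK mulmx1.
Qed.

Lemma wgrad_reflect Y : wgrad (Q *m Y) = Q *m wgrad Y.
Proof.
rewrite /wgrad resid_reflect fnorm_reflect -scalemxAr; congr (_ *: _).
move: (resid S Y) => E; rewrite -!mulmxA; congr (_ *m (_ *m _)).
by rewrite mulmxA reflect_S_mx.
Qed.

Lemma reflect_horizontal (V : 'M[R]_(d, r)) : X^T *m V = 0 -> Q *m V = - V.
Proof. by move=> XV; rewrite /Q mulmxBl -scalemxAl -mulmxA XV mulmx0 scaler0 sub0r mul1mx. Qed.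

Lemma wgrad_limit_horizontal (Ys : nat -> 'M[R]_(d, r)) g :
  (forall t, stiefel (Ys t)) -> mx_cvg Ys X -> mx_cvg (fun t => wgrad (Ys t)) g ->
  X^T *m g = 0.
Proof.
move=> Yst YX gg; apply: mx_cvg_unique (mx_cvgM (mx_cvg_tr YX) gg) _.
by apply: (mx_cvg_eventually (N := 0) _ (mx_cvg_cst 0)) => t _; rewrite wgrad_horizontal.
Qed.

Lemma clarke_subdiff_shrink (Ys : nat -> 'M[R]_(d, r)) g l :
  (forall t, stiefel (Ys t)) -> (forall t, resid S (Ys t) != 0) ->
  mx_cvg Ys X -> mx_cvg (fun t => wgrad (Ys t)) g -> 0 <= l <= 1 ->
  clarke_subdiff w X (l *: g).
Proof.
move=> Yst Y0 YX gg /andP[l_ge0 l_le1].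
have Xg := wgrad_limit_horizontal Yst YX gg.
(* The weights have sum 1 and difference [l], and are nonnegative since [0 <= l <= 1]. *)
have -> : l *: g = ((1 + l) / 2) *: g + ((1 - l) / 2) *: (- g).
  by rewrite scalerN -scalerBl; congr (_ *: _); field.
apply: conv_hull_segment; [| |lra|lra|by field].
- split; first exact: tangent_horizontal.
  by exists Ys, (wgrad \o Ys); split=> // t; exact: is_rgrad_wfun.
- split; first by apply: tangent_horizontal; rewrite mulmxN Xg oppr0.
  exists (fun t => Q *m Ys t), (fun t => wgrad (Q *m Ys t)); split=> [t|t||].
  + exact: stiefel_reflect.
  + apply: is_rgrad_wfun; first exact: stiefel_reflect.
    by rewrite -fnorm_eq0 resid_reflect fnorm_reflect fnorm_eq0.
  + by rewrite -[X in mx_cvg _ X]reflect_mx_fix; exact: mx_cvgM (mx_cvg_cst Q) YX.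
  (* Since [g] is horizontal at [X], the limit [- g] can be read as [Q *m g]. *)
  rewrite -reflect_horizontal //.
  apply: (mx_cvg_eventually (N := 0) _ (mx_cvgM (mx_cvg_cst Q) gg)) => t _.
  by rewrite wgrad_reflect.
Qed.

End Reflection.

End WGradient.

(** * Limits of smoothed gradients, by the value of [wfun] at the limit point *)

Section Main.
Variables (R : realType) (d r : nat) (S : 'M[R]_d) (rho : R).
Hypotheses (S_sym : S^T = S) (rho_gt0 : 0 < rho).
Implicit Types X Y G : 'M[R]_(d, r).
Local Notation w := (@wfun R d r S rho).
Local Notation wgrad := (@wgrad R d r S rho).

(** Uniqueness of Euclidean gradients identifies [Vs t] with a multiple of [wgrad]; being
    horizontal, it is unchanged by the projection. *)
Lemma smoothing_subdiff_wgrad X G : smoothing_subdiff S rho X G ->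
  exists (Xs : nat -> 'M[R]_(d, r)) (mus : nat -> R),
    [/\ forall t, stiefel (Xs t), mx_cvg Xs X, forall t, 0 < mus t, seq_cvg mus 0 &
        mx_cvg (fun t => (w (Xs t) / Num.max (mus t * rho) (w (Xs t))) *: wgrad (Xs t)) G].
Proof.
move=> [_ [Xs [Vs [mus [Xst XsX [mus_gt0 _ mus0] Vgrad VG]]]]].
exists Xs, mus; split=> //; apply: (mx_cvg_eventually (N := 0) _ VG) => t _.
rewrite (is_egrad_unique (Vgrad t) (is_egrad_wtilde S_sym rho_gt0 (Xst t) (mus_gt0 t))).
apply: proj_tangent_id; apply: tangent_horizontal.
by rewrite -scalemxAr wgrad_horizontal // scaler0.
Qed.

Lemma clarke_subdiff_pos X G : resid S X != 0 -> tangent X G ->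
  smoothing_subdiff S rho X G -> clarke_subdiff w X G.
Proof.
move=> X0 XG /smoothing_subdiff_wgrad[Xs [mus [Xst XsX mus_gt0 mus0 gG]]].
(* This threshold serves twice: eventually the residual norms exceed it and [mus t] is below it,
   which forces [mus t * rho <= w (Xs t)]. *)
have e_gt0 : 0 < fnorm (resid S X) / 2 by rewrite divr_gt0 ?fnorm_resid_gt0.
have [N1 XN] := mx_cvg_resid S XsX e_gt0.
have [N2 musN] := mus0 _ e_gt0.
pose N := maxn N1 N2.
have resid_gt t : (N <= t)%N -> fnorm (resid S X) / 2 < fnorm (resid S (Xs t)).
  rewrite geq_max => /andP[/XN h _].
  have := ler_fnormD (resid S X - resid S (Xs t)) (resid S (Xs t)).
  by rewrite subrK fnormBC; lra.
(* Gradients must exist at every index, so the sequence is shifted past the first [N] terms. *)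
have shiftX : mx_cvg (Xs \o addn N) X by apply: mx_cvg_sub => // k; exact: leq_addl.
have shiftG := mx_cvg_sub (fun k => leq_addl N k) gG.
apply: conv_hull_mem; split=> //; exists (Xs \o addn N), (wgrad \o (Xs \o addn N)).
split=> [t|t||] //=.
- apply: is_rgrad_wfun => //; rewrite -fnorm_eq0 gt_eqF //.
  by apply: lt_trans e_gt0 (resid_gt _ _); exact: leq_addr.
apply: (mx_cvg_eventually (N := 0) _ shiftG) => t _ /=.
have Nt : (N <= N + t)%N by exact: leq_addr.
have := musN _ (leq_trans (leq_maxr _ _) Nt); rewrite subr0 gtr0_norm // => mut.
have mu_w : mus (N + t)%N * rho <= w (Xs (N + t)%N).
  have := resid_gt _ Nt; have := mus_gt0 (N + t)%N.
  by rewrite /wfun -/(resid S _) [leLHS]mulrC [2 * rho]mulrC -mulrA ler_pM2l //; lra.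
rewrite (max_idPr mu_w) divff ?scale1r // gt_eqF // (lt_le_trans _ mu_w) //.
by rewrite mulr_gt0.
Qed.

Lemma clarke_subdiff_zero X G : stiefel X -> resid S X = 0 ->
  smoothing_subdiff S rho X G -> clarke_subdiff w X G.
Proof.
move=> XX X0 /smoothing_subdiff_wgrad[Xs [mus [Xst XsX mus_gt0 mus0 gG]]].
(* If all nearby points of the manifold are zeros of [w], there are no nonzero residuals to
   approximate with, but then [G] can only be 0. *)
have [[eps eps_gt0 near0]|nonzero] := pselect (exists2 eps : R, 0 < eps &
    forall Y, stiefel Y -> fnorm (Y - X) < eps -> resid S Y = 0).
  have -> : G = 0.
    have [N XN] := XsX _ eps_gt0; apply: mx_cvg_unique gG _.
    apply: (mx_cvg_eventually (N := N) _ (mx_cvg_cst 0)) => t Nt.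
    by rewrite wgrad_resid0 ?scaler0 // near0 // XN.
  have tangent0 : tangent X 0 by apply: tangent_horizontal; rewrite mulmx0.
  apply: conv_hull_mem; split=> //.
  (* [w] vanishes on the manifold near [X], so 0 is its Riemannian gradient at [X] itself. *)
  exists (fun=> X), (fun=> 0); split=> // [t||]; [|exact: mx_cvg_cst|exact: mx_cvg_cst].
  split=> // e e_gt0; exists eps => // Y YY /(near0 _ YY) Y0.
  rewrite /wfun -/(resid S _) -/(resid S X) X0 Y0 fnorm0 mulr0 subrr sub0r normrN.
  by rewrite -(scale0r 0) finnerZl mul0r normr0 mulr_ge0 ?fnorm_ge0 // ltW.
(* Points [Xs t] with zero residual are replaced by points near [X] with nonzero residual, with
   coefficient 0 so that the scaled gradient is unchanged. *)
have /choice[Yl Ylt] (t : nat) : exists Yl : 'M[R]_(d, r) * R,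
    [/\ stiefel Yl.1, resid S Yl.1 != 0,
        fnorm (Yl.1 - X) <= fnorm (Xs t - X) + t.+1%:R^-1, 0 <= Yl.2 <= 1 &
        (w (Xs t) / Num.max (mus t * rho) (w (Xs t))) *: wgrad (Xs t) = Yl.2 *: wgrad Yl.1].
  have [Xt0|Xt0] := eqVneq (resid S (Xs t)) 0; last first.
    exists (Xs t, w (Xs t) / Num.max (mus t * rho) (w (Xs t))) => /=; split=> //.
      by rewrite lerDl invr_ge0.
    have m_gt0 : 0 < Num.max (mus t * rho) (w (Xs t)) by rewrite lt_max mulr_gt0.
    rewrite divr_ge0 ?wfun_ge0 ?(ltW m_gt0) //.
    by rewrite ler_pdivrMr // mul1r le_max lexx orbT.
  have [Y [YY YX Y0]] : exists Y, [/\ stiefel Y, fnorm (Y - X) < t.+1%:R^-1 & resid S Y != 0].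
    apply: contrapT => /forallNP noY; apply: nonzero; exists t.+1%:R^-1.
      by rewrite invr_gt0.
    move=> Y YY YX.
    by apply: contrapT => /eqP Y0; apply: (noY Y).
  exists (Y, 0) => /=; split; rewrite ?lexx ?ler01 //.
    by rewrite (le_trans (ltW YX)) // lerDr fnorm_ge0.
  by rewrite wgrad_resid0 // scaler0 scale0r.
have YX : mx_cvg (fun t => (Yl t).1) X.
  move=> eps eps_gt0; have e2 : 0 < eps / 2 by rewrite divr_gt0.
  have [N XN] := XsX _ e2.
  (* The Archimedean bound makes [t.+1%:R^-1] smaller than [eps / 2]. *)
  exists (maxn N (Num.bound (eps / 2)^-1)) => t; rewrite geq_max => /andP[/XN Xt tN].
  have [_ _ h _ _] := Ylt t; apply: le_lt_trans h _; rewrite [eps]splitr ltrD //.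
  rewrite invf_plt ?posrE //; apply: lt_le_trans (archi_boundP _) _.
    by rewrite invr_ge0 ltW.
  by rewrite ler_nat leqW.
have l01 t : `|(Yl t).2| <= 1.
  by have [_ _ _ /andP[l_ge0 l_le1] _] := Ylt t; rewrite ger0_norm.
(* Coefficients, then gradients, are made to converge; the common reindexing is [f1] after [f2]. *)
have [f1 [l [f1k f1l]]] := bounded_seq_subcvg l01.
have Yst t : stiefel (Yl t).1 by have [] := Ylt t.
have [f2 [g [f2k f2g]]] := bounded_mx_subcvg (u := fun t => wgrad (Yl (f1 t)).1)
  (fun t => fnorm_wgrad_le S rho_gt0 (Yst _)).
have f12k k : (k <= f1 (f2 k))%N by apply: leq_trans (f2k k) (f1k _).
have f12l := seq_cvg_sub f2k f1l.
have -> : G = l *: g.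
  apply: mx_cvg_unique (mx_cvg_sub f12k gG) _.
  apply: (mx_cvg_eventually (N := 0) _ (mx_cvgZ f12l f2g)) => t _ /=.
  by have [_ _ _ _ ->] := Ylt (f1 (f2 t)).
apply: (@clarke_subdiff_shrink _ _ _ _ _ S_sym rho_gt0 _ XX X0 (fun t => (Yl (f1 (f2 t))).1)) => //.
- by move=> t; have [] := Ylt (f1 (f2 t)).
- exact: mx_cvg_sub f12k YX.
(* The bounds on the coefficients pass to their limit [l]. *)
apply/andP; split; apply/ler_addgt0Pr => e e_gt0.
  have [N lN] := f12l _ e_gt0; have := lN _ (leqnn N); rewrite ltr_norml.
  have [_ _ _ /andP[l_ge0 _] _] := Ylt (f1 (f2 N)) => /andP[_] /=; lra.
have [N lN] := f12l _ e_gt0; have := lN _ (leqnn N); rewrite ltr_norml.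
have [_ _ _ /andP[_ l_le1] _] := Ylt (f1 (f2 N)) => /andP[+ _] /=; lra.
Qed.

End Main.

(** The square root of [Sigma] enters as a variable [S], characterised by [psd S] and
    [S *m S = Sigma]. *)
Theorem mainTheorem8 (R : realType) (d r : nat) (Sigma S : 'M[R]_d) (rho : R)
  (X G : 'M[R]_(d, r)) :
  (1 <= r)%N -> (r < d)%N ->
  psd Sigma -> psd S -> S *m S = Sigma ->
  0 < rho ->
  stiefel X ->
  smoothing_subdiff S rho X G ->
  clarke_subdiff (wfun S rho) X G.
Proof.
move=> _ _ _ [S_sym _] _ rho_gt0 XX XG.
have [X0|X0] := eqVneq (resid S X) 0; first exact: clarke_subdiff_zero.
by apply: clarke_subdiff_pos => //; case: XG.
Qed.
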